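(* Let $D$ be an integral domain with fraction field $k$. Let $(T, M)$ be a local domain with residue field $k = T/M$, let $\pi : T \twoheadrightarrow k$ be the canonical surjection, and let $D \times_k T = \{t \in T \mid \pi(t) \in D\}$. If the pullback $D \times_k T$ is globally perinormal, then $D$ and $T$ are globally perinormal. If $T$ is a valuation domain and $D$ is globally perinormal, then $D \times_k T$ is globally perinormal.
   Context: All rings are commutative with $1$. A local domain $(T,M)$ is an integral domain $T$ with unique maximal ideal $M$ (no Noetherian assumption). An overring of an integral domain $R$ is a ring $S$ with $R \subseteq S \subseteq \operatorname{Frac}(R)$. An overring $S$ of $R$ is flat if it is flat as an $R$-module, and it is a going-down overring if the inclusion $R \subseteq S$ satisfies going-down: whenever $\mathfrak{p} \subseteq \mathfrak{q}$ are primes of $R$ and $Q$ is a prime of $S$ with $Q \cap R = \mathfrak{q}$, there is a prime $P \subseteq Q$ of $S$ with $P \cap R = \mathfrak{p}$. A localization of $R$ is an overring of the form $R_W$ for a multiplicative subset $W$ of $R$ with $0 \notin W$. A domain $R$ is perinormal if every going-down overring of $R$ is flat over $R$. A domain $R$ is globally perinormal if it is perinormal and every flat overring of $R$ is a localization of $R$. *)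

(* Defs.v *)
From HB Require Import structures.
From mathcomp Require Import all_boot all_order all_algebra.
From mathcomp Require Import ring_quotient fraction.
From mathcomp Require Import boolp.

Set Implicit Arguments.
Unset Strict Implicit.
Unset Printing Implicit Defensive.

Import GRing.Theory.
Local Open Scope ring_scope.

(* Subsets (ideals, subrings, multiplicative sets) are boolean predicates; with
   the classical axioms of boolp every Prop-valued predicate P is of this form,
   via `[< P x >]. *)

Local Notation fracEmb R := (@FracField.tofrac R).

Section Subring.
Variables (R : idomainType) (A : subringClosed R).

Record subring := Subring { srval : R; srvalP : srval \in A }.

HB.instance Definition _ := [isSub for srval].
HB.instance Definition _ := [Choice of subring by <:].
HB.instance Definition _ := [SubChoice_isSubComNzRing of subring by <:].

Definition sr_unit : pred subring :=
  fun x => (srval x \is a GRing.unit) && ((srval x)^-1 \in A).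

Definition sr_inv (x : subring) : subring :=
  if sr_unit x then insubd x (srval x)^-1 else x.

Lemma srval_inv x : sr_unit x -> srval (sr_inv x) = (srval x)^-1.
Proof.
by move=> ux; rewrite /sr_inv ux -[LHS]/(val _) insubdK //; case/andP: ux.
Qed.

Lemma sr_mulVr : {in sr_unit, left_inverse 1 sr_inv *%R}.
Proof.
move=> x ux; apply: val_inj; rewrite rmorphM rmorph1 /= srval_inv //.
by rewrite mulVr //; case/andP: ux.
Qed.

Lemma sr_unitP (x y : subring) : y * x = 1 -> sr_unit x.
Proof.
move/(congr1 val); rewrite rmorphM rmorph1 /= => yx1.
have ux : srval x \is a GRing.unit.
  by apply/unitrP; exists (srval y); split; rewrite // mulrC.
rewrite /sr_unit ux /= -[_^-1]mul1r -yx1 mulrK //; exact: srvalP.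
Qed.

Lemma sr_inv_out : {in [predC sr_unit], sr_inv =1 id}.
Proof. by move=> x; rewrite inE /sr_inv => /negbTE; rewrite -topredE /= => ->. Qed.

HB.instance Definition _ :=
  GRing.ComNzRing_hasMulInverse.Build subring sr_mulVr sr_unitP sr_inv_out.

Lemma sr_integral (x y : subring) : x * y = 0 -> (x == 0) || (y == 0).
Proof.
move/(congr1 val); rewrite rmorphM rmorph0 /= => /eqP; rewrite mulf_eq0.
by case/orP => /eqP e; apply/orP; [left | right]; apply/eqP/val_inj.
Qed.

HB.instance Definition _ := GRing.ComUnitRing_isIntegral.Build subring sr_integral.

End Subring.

(* The pullback D x_k T, for pi : T -> k with k = Frac D, as a subring of T. *)
Section Pullback.
Variables (D T : idomainType) (pi : {rmorphism T -> {fraction D}}).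

Definition pullback_pred : pred T := fun t => `[< exists d : D, pi t = fracEmb D d >].

Lemma pullback_closed : GRing.subring_closed pullback_pred.
Proof.
split=> [|x y /asboolP[a xa] /asboolP[b yb]|x y /asboolP[a xa] /asboolP[b yb]];
  apply/asboolP.
- by exists 1; rewrite !rmorph1.
- by exists (a - b); rewrite !rmorphB xa yb.
- by exists (a * b); rewrite !rmorphM xa yb.
Qed.

HB.instance Definition _ :=
  GRing.isSubringClosed.Build T pullback_pred pullback_closed.

Definition pullback_subring : subringClosed T :=
  GRing.SubringClosed.clone T pullback_pred _.

Definition pullback : idomainType := subring pullback_subring.

End Pullback.

Section Ideals.
Variable R : comNzRingType.

(* Note that idealr_closed only holds of proper ideals. *)
Definition maximal_ideal (M : {pred R}) : Prop :=
  idealr_closed M /\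
  forall J : {pred R}, idealr_closed J -> {subset M <= J} -> J =i M.

Definition local_ring (M : {pred R}) : Prop :=
  maximal_ideal M /\ forall N : {pred R}, maximal_ideal N -> N =i M.

End Ideals.

Definition valuation_domain (T : idomainType) : Prop :=
  forall x : {fraction T}, x != 0 ->
    (exists t : T, x = fracEmb T t) \/ (exists t : T, x^-1 = fracEmb T t).

(* The tensor product of A and N over R is the quotient of the set of formal
   sums  a1 (x) n1 + ... + ar (x) nr,  represented by lists of pairs, by the
   congruence tensor_eq. Opposites are given by (- a) (x) n. *)
Section Tensor.
Variables (R : comNzRingType) (A N : lmodType R).

Inductive tensor_eq : seq (A * N) -> seq (A * N) -> Prop :=
| tensor_refl u : tensor_eq u u
| tensor_sym u v : tensor_eq u v -> tensor_eq v u
| tensor_trans u v w : tensor_eq u v -> tensor_eq v w -> tensor_eq u w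
| tensor_cat u u' v v' :
    tensor_eq u u' -> tensor_eq v v' -> tensor_eq (u ++ v) (u' ++ v')
| tensor_catC u v : tensor_eq (u ++ v) (v ++ u)
| tensor_0l n : tensor_eq [:: (0, n)] [::]
| tensor_Dl a b n : tensor_eq [:: (a + b, n)] [:: (a, n); (b, n)]
| tensor_Dr a m n : tensor_eq [:: (a, m + n)] [:: (a, m); (a, n)]
| tensor_Z r a n : tensor_eq [:: (r *: a, n)] [:: (a, r *: n)].

End Tensor.

(* Tensoring with N preserves injectivity of linear maps. *)
Definition flat_module (R : comNzRingType) (N : lmodType R) : Prop :=
  forall (A B : lmodType R) (f : {linear A -> B}), injective f ->
  forall u v : seq (A * N),
    tensor_eq [seq (f x.1, x.2) | x <- u] [seq (f x.1, x.2) | x <- v] ->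
    tensor_eq u v.

Definition restrict_scalars (R S : comNzRingType) (f : {rmorphism R -> S}) : Type :=
  S.

Section RestrictScalars.
Variables (R S : comNzRingType) (f : {rmorphism R -> S}).
Local Notation Sf := (restrict_scalars f).

HB.instance Definition _ := GRing.Zmodule.copy Sf S.

Definition rs_scale (r : R) (s : Sf) : Sf := f r * (s : S).

Lemma rs_scaleA a b v : rs_scale a (rs_scale b v) = rs_scale (a * b) v.
Proof. by rewrite /rs_scale mulrA rmorphM. Qed.

Lemma rs_scale1 : left_id 1 rs_scale.
Proof. by move=> v; rewrite /rs_scale rmorph1 mul1r. Qed.

Lemma rs_scaleDr : right_distributive rs_scale +%R.
Proof. by move=> a u v; rewrite /rs_scale mulrDr. Qed.

Lemma rs_scaleDl v : {morph rs_scale^~ v : a b / a + b}.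
Proof. by move=> a b; rewrite /rs_scale rmorphD mulrDl. Qed.

HB.instance Definition _ :=
  GRing.Zmodule_isLmodule.Build R Sf rs_scaleA rs_scale1 rs_scaleDr rs_scaleDl.

End RestrictScalars.

Definition flat_morphism (R S : comNzRingType) (f : {rmorphism R -> S}) : Prop :=
  flat_module (restrict_scalars f).

Definition going_down (R S : comNzRingType) (f : {rmorphism R -> S}) : Prop :=
  forall (p q : prime_idealr R) (Q : prime_idealr S),
    {subset p <= q} -> (forall x, (f x \in Q) = (x \in q)) ->
    exists P : prime_idealr S,
      {subset P <= Q} /\ forall x, (f x \in P) = (x \in p).

Record overring (R : idomainType) := Overring {
  overring_set :> subringClosed {fraction R};
  overringP : forall r : R, fracEmb R r \in overring_set }.

Section Overring.
Variables (R : idomainType) (S : overring R).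

Definition incl (r : R) : subring S := Subring (overringP S r).

Lemma incl_zmod_morphism : zmod_morphism incl.
Proof. by move=> x y; apply: val_inj; rewrite /= rmorphB. Qed.

Lemma incl_monoid_morphism : monoid_morphism incl.
Proof. by split=> [|x y]; apply: val_inj; rewrite /= ?rmorph1 ?rmorphM. Qed.

HB.instance Definition _ :=
  GRing.isZmodMorphism.Build R (subring S) incl incl_zmod_morphism.
HB.instance Definition _ :=
  GRing.isMonoidMorphism.Build R (subring S) incl incl_monoid_morphism.

Definition flat_overring : Prop := flat_morphism incl.

Definition going_down_overring : Prop := going_down incl.

Definition is_localization : Prop :=
  exists W : {pred R}, [/\ GRing.mulr_closed W, 0 \notin W &
    forall x : {fraction R}, x \in overring_set S <->
      exists a w : R, w \in W /\ x = fracEmb R a / fracEmb R w].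

End Overring.

Definition perinormal (R : idomainType) : Prop :=
  forall S : overring R, going_down_overring S -> flat_overring S.

Definition globally_perinormal (R : idomainType) : Prop :=
  perinormal R /\ forall S : overring R, flat_overring S -> is_localization S.

(* Main.v *)
(* Write R for the pullback, so that M is a prime ideal of R, T = R_M and D = R/M,
   and R and T have the same fraction field. Three facts drive the proof.
   - Richman: an overring S of R is flat iff (R : x)S = S for every x in S.
   - Overrings of R inside T are the preimages of the overrings E of D. Flatness
     and being a localization transfer between E and its preimage since 1 + M
     consists of units; going-down transfers since every prime of R is comparable
     with M and the primes contained in M are the primes of T.
   - If T is a valuation domain, an overring of R not contained in T contains T
     and is a localization of R, hence flat.
   Subrings of a field K and their primes are encoded as predicates on K; all
   rings with fraction field K then live in the same type. *)

Require Import Defs.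
From HB Require Import structures.
From mathcomp Require Import all_boot all_order all_algebra.
From mathcomp Require Import ring_quotient fraction.
From mathcomp Require Import boolp classical_sets ring.
Set Implicit Arguments.
Unset Strict Implicit.
Unset Printing Implicit Defensive.
Import GRing.Theory.
Local Open Scope ring_scope.

(** * Richman's criterion for flatness *)

Section FlatSufficient.
Variables (R S : comNzRingType) (f : {rmorphism R -> S}).
Hypothesis f_inj : injective f.
Local Notation Sf := (restrict_scalars f).

(* The elements all of whose multiples satisfy G generate the unit ideal of S. *)
Definition dense (G : R -> Prop) : Prop :=
  exists l : seq (R * S), \sum_(z <- l) f z.1 * z.2 = 1 /\
    forall z, z \in l -> forall r, G (r * z.1).

(** The conductor (R : y); [dense (clears y)] says that it generates the unit ideal of [S]. *)
Definition clears (y : S) (r : R) : Prop := exists c, f c = f r * y.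

(** Multiplying the two expressions of 1 gives an expression of 1 in which every new generator is a
    multiple of one from each family. *)
Lemma dense_and (G H : R -> Prop) :
  dense G -> dense H -> dense (fun r => G r /\ H r).
Proof.
move=> [l [l1 lG]] [m [m1 mH]].
exists [seq (z.1 * w.1, z.2 * w.2) | z <- l, w <- m]; split.
  rewrite big_allpairs_dep /= -[RHS]mulr1 -{1}l1 -m1 mulr_suml.
  apply: eq_bigr => z _; rewrite mulr_sumr; apply: eq_bigr => w _.
  by rewrite rmorphM mulrACA.
move=> _ /allpairsP[[z w] /= [zl wm ->]] r; split=> /=.
  by rewrite [z.1 * _]mulrC mulrA; exact: lG.
by rewrite mulrA; exact: mH.
Qed.

Lemma dense_impl (G H : R -> Prop) :
  (forall r, G r -> H r) -> dense G -> dense H.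
Proof. by move=> GH [l [l1 lG]]; exists l; split=> // z zl r; exact/GH/lG. Qed.

(* The element r y of R, when r clears the denominator of y; junk otherwise. *)
Definition coef (r : R) (y : S) : R := xget 0 [set c | f c = f r * y]%classic.

Lemma coefP y r : clears y r -> f (coef r y) = f r * y.
Proof. by move=> cl; exact: (@xgetPex _ 0 [set c | f c = f r * y]%classic cl). Qed.

Section Evaluation.
Variable A : lmodType R.

Definition clears_all (u : seq (A * Sf)) (r : R) : Prop :=
  forall z, z \in u -> clears z.2 r.

(** The tensor [u] multiplied by [r] and read back in [A], meaningful when [r] clears all second
    components. *)
Definition evalt (r : R) (u : seq (A * Sf)) : A :=
  \sum_(z <- u) coef r z.2 *: z.1.

Lemma tensor_cons (x : A * Sf) (u v : seq (A * Sf)) :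
  tensor_eq u v -> tensor_eq (x :: u) (x :: v).
Proof. by move=> uv; apply: (@tensor_cat _ _ _ [:: x] [:: x]) uv; exact: tensor_refl. Qed.

Lemma tensor_0r (a : A) : tensor_eq [:: (a, 0 : Sf)] [::].
Proof.
rewrite -[X in (a, X)](scale0r (0 : Sf)).
apply: (tensor_trans (tensor_sym (tensor_Z 0 a (0 : Sf)))).
by rewrite scale0r; exact: tensor_0l.
Qed.

Lemma tensor_split (c d : S) (u : seq (A * Sf)) :
  tensor_eq [seq (x.1, (c + d) * (x.2 : S) : Sf) | x <- u]
            ([seq (x.1, c * (x.2 : S) : Sf) | x <- u] ++
             [seq (x.1, d * (x.2 : S) : Sf) | x <- u]).
Proof.
elim: u => [|[a y] u IH] /=; first exact: tensor_refl.
rewrite mulrDl -cat1s.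
apply: (tensor_trans (tensor_cat (tensor_Dr a (c * (y : S) : Sf) _) IH)) => /=.
apply: tensor_cons; rewrite -cat1s catA -[X in tensor_eq _ (_ ++ X)]cat1s catA.
by apply: tensor_cat (tensor_refl _); exact: tensor_catC.
Qed.

(** The cleared coefficients r y lie in [R], so they move across the tensor sign onto [s]. *)
Lemma tensor_evalt (r : R) (s : S) (u : seq (A * Sf)) : clears_all u r ->
  tensor_eq [:: (evalt r u, s : Sf)]
            [seq (x.1, (f r * s) * (x.2 : S) : Sf) | x <- u].
Proof.
rewrite /evalt; elim: u => [|[a y] u IH] cl; first by rewrite big_nil; exact: tensor_0l.
rewrite big_cons.
apply: (tensor_trans (tensor_Dl _ _ _)).
rewrite map_cons -cat1s -[X in tensor_eq _ X]cat1s; apply: tensor_cat.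
  apply: (tensor_trans (tensor_Z _ _ _)) => /=.
  have cy : clears y r by apply: (cl (a, y)); rewrite mem_head.
  have e : f (coef r y) * s = (f r * s) * (y : S) by rewrite (coefP cy) mulrAC.
  rewrite -e; exact: tensor_refl.
by apply: IH => z zu; apply: cl; rewrite in_cons zu orbT.
Qed.

(** When the sum over [l] is 1, the left side is [u] itself: a tensor is recovered from its
    evaluations at the first entries of [l]. *)
Lemma tensor_expand (l : seq (R * S)) (u : seq (A * Sf)) :
  (forall z, z \in l -> clears_all u z.1) ->
  tensor_eq [seq (x.1, (\sum_(z <- l) f z.1 * z.2) * (x.2 : S) : Sf) | x <- u]
            [seq (evalt z.1 u, z.2 : Sf) | z <- l].
Proof.
elim: l => [|z l IH] cl /=.
  rewrite big_nil; elim: u {cl} => [|x u IH] /=; first exact: tensor_refl.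
  by rewrite mul0r -cat1s -[[::]]cats0; apply: tensor_cat IH; exact: tensor_0r.
rewrite big_cons; apply: (tensor_trans (tensor_split _ _ _)).
rewrite -[X in tensor_eq _ X]cat1s; apply: tensor_cat.
  by apply/tensor_sym/tensor_evalt/cl; rewrite mem_head.
by apply: IH => w wl; apply: cl; rewrite in_cons wl orbT.
Qed.

End Evaluation.

Hypothesis dense_clears : forall y, dense (clears y).

Lemma dense_clears_all (A : lmodType R) (u : seq (A * Sf)) : dense (clears_all u).
Proof.
elim: u => [|x u IH]; first by exists [:: (1, 1)]; split; rewrite ?big_seq1 ?rmorph1 ?mulr1.
apply: dense_impl (dense_and (dense_clears x.2) IH) => r [xr ur] z.
by rewrite inE => /orP[/eqP ->|/ur].
Qed.

(* An equality of tensors only involves finitely many elements of S, so it becomes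
   an equality in A after multiplication by a common denominator. *)
Lemma tensor_eq_dense (A : lmodType R) (u v : seq (A * Sf)) : tensor_eq u v ->
  dense (fun r => [/\ clears_all u r, clears_all v r & evalt r u = evalt r v]).
Proof.
(* Each rule may assume that both sides are cleared, so only the two evaluations remain to be
   compared. *)
have both (G : R -> Prop) u' v' : dense G ->
    (forall r, G r -> clears_all u' r -> clears_all v' r -> evalt r u' = evalt r v') ->
    dense (fun r => [/\ clears_all u' r, clears_all v' r &
      evalt r u' = evalt r v' :> A]).
  move=> dG Guv; have := dense_and dG
    (dense_and (@dense_clears_all A u') (@dense_clears_all A v')).
  by apply: dense_impl => r [Gr [ur vr]]; split=> //; exact: Guv.
have triv := @dense_clears_all A [::].
elim=> {u v}.
- by move=> u; apply: (both _ _ _ triv).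
- by move=> u v _; apply: dense_impl => r [].
- move=> u v w _ duv _ dvw; apply: dense_impl (dense_and duv dvw).
  by move=> r [[ur _ ->] [_ wr ->]].
- move=> u u' v v' _ du _ dv; apply: (both _ _ _ (dense_and du dv)).
  by move=> r [[_ _ uu'] [_ _ vv']] _ _; move: uu' vv'; rewrite /evalt !big_cat /= => -> ->.
- by move=> u v; apply: (both _ _ _ triv) => r _ _ _; rewrite /evalt !big_cat /= addrC.
- by move=> n; apply: (both _ _ _ triv) => r _ _ _; rewrite /evalt big_seq1 big_nil scaler0.
- move=> a b n; apply: (both _ _ _ triv) => r _ _ _.
  by rewrite /evalt !big_cons big_nil /= !addr0 scalerDr.
- move=> a m n; apply: (both _ _ _ triv) => r _ cmn cm.
  have clm := cm (a, m); have cln := cm (a, n); have clmn := cmn (a, m + n).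
  rewrite /evalt !big_cons big_nil /= !addr0 -scalerDl; congr (_ *: _).
  (* Injectivity of [f] makes the cleared element of [R] unique, so the chosen coefficients are
     additive. *)
  apply: f_inj; rewrite rmorphD !coefP ?mulrDr //.
  - by apply: cln; rewrite !inE eqxx orbT.
  - by apply: clm; rewrite !inE eqxx.
  - by apply: clmn; rewrite mem_head.
- move=> r a n; apply: (both _ _ _ triv) => t _ cn crn.
  rewrite /evalt !big_seq1 /= scalerA; congr (_ *: _).
  apply: f_inj; rewrite rmorphM !coefP ?[RHS]/(f t * (f r * n)).
  - by rewrite -mulrA [(n : S) * _]mulrC.
  - by apply: (crn (a, r *: n)); rewrite mem_head.
  - by apply: (cn (r *: a, n)); rewrite mem_head.
Qed.

(** Equality after [h] forces h (evalt r u) = h (evalt r v) for a family of r generating the unit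
    ideal; injectivity removes [h], and [tensor_expand] rebuilds [u] and [v] from equal
    evaluations. *)
Lemma flat_of_dense_clears : flat_morphism f.
Proof.
move=> A B h h_inj u v /tensor_eq_dense[l [l1 lP]].
have evalt_map r w : evalt r [seq (h x.1, x.2) | x <- w] = h (evalt r w).
  by rewrite /evalt big_map linear_sum; apply: eq_bigr => z _; rewrite linearZ_LR.
have cl w z : clears_all [seq (h x.1, x.2) | x <- w] z -> clears_all w z.
  move=> cw x xw; exact: (cw (h x.1, x.2) (map_f (fun x => (h x.1, x.2)) xw)).
have mul1 (w : seq (A * Sf)) : w =
    [seq (x.1, (\sum_(z <- l) f z.1 * z.2) * (x.2 : S) : Sf) | x <- w].
  by rewrite l1 -[LHS]map_id; apply: eq_map => -[a y] /=; rewrite mul1r.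
have lP' z : z \in l -> [/\ clears_all u z.1, clears_all v z.1 & evalt z.1 u = evalt z.1 v].
  move=> zl; have [] := lP z zl 1; rewrite mul1r !evalt_map.
  by move=> /cl cu /cl cv /h_inj.
rewrite (mul1 u) (mul1 v).
apply: (tensor_trans (tensor_expand (u := u) _)) => [z /lP'[]//|].
apply/tensor_sym; apply: (tensor_trans (tensor_expand (u := v) _)) => [z /lP'[]//|].
rewrite (_ : [seq _ | _ <- l] = [seq (evalt z.1 u, z.2 : Sf) | z <- l]).
  exact: tensor_refl.
by apply/eq_in_map => z /lP'[_ _ ->].
Qed.

End FlatSufficient.

(** * Necessity: flatness tested on ideals with two generators *)

Section TwoGenerated.
Variables (R : comNzRingType) (a b : R).

Definition gen2_pred : pred R^o :=
  fun r => `[< exists u v : R, r = u * a + v * b >].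

Lemma gen2_closed : GRing.submod_closed gen2_pred.
Proof.
split; first by apply/asboolP; exists 0, 0; rewrite !mul0r addr0.
move=> c _ _ /asboolP[u [v ->]] /asboolP[u' [v' ->]]; apply/asboolP.
exists (c * u + u'), (c * v + v').
change (c * (u * a + v * b) + (u' * a + v' * b) =
  (c * u + u') * a + (c * v + v') * b); ring.
Qed.

HB.instance Definition _ :=
  GRing.isSubmodClosed.Build R R^o gen2_pred gen2_closed.

Record gen2 := Gen2 { gen2_val : R^o; gen2P : gen2_val \in gen2_pred }.
HB.instance Definition _ := [isSub for gen2_val].
HB.instance Definition _ := [Choice of gen2 by <:].
HB.instance Definition _ := [SubChoice_isSubLmodule of gen2 by <:].

Variables (S : comNzRingType) (f : {rmorphism R -> S}).
Local Notation Sf := (restrict_scalars f).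

(* Membership in the extended ideal (b : a)S. *)
Definition colon_ext (s : S) : Prop :=
  exists l : seq (R * S), (forall z, z \in l -> exists c, z.1 * a = c * b) /\
    \sum_(z <- l) f z.1 * z.2 = s.

Lemma colon_ext_add s t : colon_ext s -> colon_ext t -> colon_ext (s + t).
Proof.
move=> [l [lP <-]] [m [mP <-]]; exists (l ++ m); split; last by rewrite big_cat.
by move=> z; rewrite mem_cat => /orP[/lP|/mP].
Qed.

Lemma colon_ext_gen r s : (exists c, r * a = c * b) -> colon_ext (f r * s).
Proof.
by move=> rP; exists [:: (r, s)]; split; [move=> z; rewrite inE => /eqP-> | rewrite big_seq1].
Qed.

Lemma colon_ext0 : colon_ext 0.
Proof. by exists [::]; rewrite big_nil; split. Qed.

Lemma colon_ext_opp s : colon_ext s -> colon_ext (- s).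
Proof.
move=> [l [lP <-]]; exists [seq (z.1, - z.2) | z <- l]; split.
  by move=> _ /mapP[z /lP zP ->].
by rewrite big_map -sumrN; apply: eq_bigr => z _; rewrite mulrN.
Qed.

(** The coefficient of [a] is determined only modulo (b : a), so additivity and linearity hold only
    up to [colon_ext]. *)
Definition fstcoef (x : gen2) : R :=
  xget 0 [set u | exists v, gen2_val x = u * a + v * b]%classic.

Lemma fstcoefP x : exists v, gen2_val x = fstcoef x * a + v * b.
Proof.
by have /asboolP xP := gen2P x;
  exact: (@xgetPex _ 0 [set u | exists v, gen2_val x = u * a + v * b]%classic xP).
Qed.

Definition fsteval (u : seq (gen2 * Sf)) : S :=
  \sum_(z <- u) f (fstcoef z.1) * (z.2 : S).

(* The bilinear map (a, b) x S -> S/(b : a)S sending (u a + v b, s) to u s. *)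
Lemma tensor_fsteval u v : tensor_eq u v -> colon_ext (fsteval u - fsteval v).
Proof.
have colon r s : (exists c, r * a = c * b) -> r = s -> colon_ext (f s).
  by move=> rP <-; rewrite -[f r]mulr1; exact: colon_ext_gen.
elim=> {u v}.
- by move=> u; rewrite subrr; exact: colon_ext0.
- by move=> u v _ /colon_ext_opp; rewrite opprB.
- by move=> u v w _ uv _ vw; have := colon_ext_add uv vw; rewrite addrA subrK.
- move=> u u' v v' _ uu' _ vv'; have := colon_ext_add uu' vv'.
  by rewrite /fsteval !big_cat /= opprD addrACA.
- by move=> u v; rewrite /fsteval !big_cat /= [X in _ - X]addrC subrr; exact: colon_ext0.
(* The coefficient chosen for 0 need not be 0, but it lies in (b : a). *)
- move=> n; rewrite /fsteval big_seq1 big_nil subr0; apply: colon_ext_gen.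
  have [v] := fstcoefP 0; rewrite [gen2_val _]/(0 : R) => /esym/eqP.
  by rewrite addr_eq0 -mulNr => /eqP ->; exists (- v).
- move=> x y n; rewrite /fsteval !big_cons big_nil /= !addr0.
  rewrite -mulrDl -mulrBl -rmorphD -rmorphB; apply: colon_ext_gen.
  have [u uE] := fstcoefP (x + y); have [v vE] := fstcoefP x; have [w wE] := fstcoefP y.
  exists (v + w - u); apply/eqP; rewrite -subr_eq0; apply/eqP.
  have : gen2_val (x + y) = gen2_val x + gen2_val y :> R by [].
  rewrite uE vE wE => /eqP; rewrite -subr_eq0 => /eqP <-.
  by rewrite !mulrBl !mulrDl !opprD !opprK; ring.
- move=> x m n; rewrite /fsteval !big_cons big_nil /= !addr0.
  by rewrite [(m + n)]/((m : S) + (n : S)) mulrDr subrr; exact: colon_ext0.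
- move=> r x n; rewrite /fsteval !big_seq1 /=.
  rewrite [r *: n]/(f r * (n : S)) mulrA -mulrBl -rmorphM -rmorphB.
  apply: colon_ext_gen.
  have [u uE] := fstcoefP (r *: x); have [v vE] := fstcoefP x.
  exists (r * v - u); have : gen2_val (r *: x) = r * gen2_val x :> R by [].
  rewrite uE vE => e; rewrite mulrBl -(addrK (u * b) (_ * a)) e; ring.
Qed.

End TwoGenerated.

(** Over [R], both a (x) 1 and b (x) y equal 1 (x) f a. Flatness moves this relation to the ideal
    (a, b), and reading first coefficients puts u1 - u2 y in (b : a)S. As 1 - u1 and u2 lie in (b :
    a), also 1 lies in (b : a)S; elements of (b : a) clear the denominator of y. *)
Lemma colon_of_flat (R : comNzRingType) (S : idomainType)
    (f : {rmorphism R -> S}) (a b : R) (y : S) :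
  flat_morphism f -> f b != 0 -> f b * y = f a ->
  exists l : seq (R * S), (forall z, z \in l -> exists c, f c = f z.1 * y) /\
    \sum_(z <- l) f z.1 * z.2 = 1.
Proof.
move=> fl b0 yE.
have aP : (a : R^o) \in gen2_pred a b.
  by apply/asboolP; exists 1, 0; rewrite mul1r mul0r addr0.
have bP : (b : R^o) \in gen2_pred a b.
  by apply/asboolP; exists 0, 1; rewrite mul1r mul0r add0r.
pose x1 := Gen2 aP; pose x2 := Gen2 bP.
have rel : tensor_eq (A := R^o) (N := restrict_scalars f) [:: (a, 1 : S)] [:: (b, y)].
  have scal (r : R) (s t : S) : t = f r * s ->
      tensor_eq (A := R^o) (N := restrict_scalars f) [:: (r, s)] [:: (1, t)].
    move=> ->; have {1}-> : r = r *: (1 : R^o) by rewrite [RHS]mulr1.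
    exact: (tensor_Z r (1 : R^o) (s : restrict_scalars f)).
  apply: tensor_trans (scal a 1 (f a) _) (tensor_sym (scal b y _ _)) => //.
  by rewrite mulr1.
have := fl (gen2 a b) R^o val val_inj [:: (x1, 1 : S)] [:: (x2, y)] rel.
move=> /tensor_fsteval; rewrite /fsteval !big_seq1 /= mulr1.
set u1 := fstcoef x1; set u2 := fstcoef x2 => ext.
have ext1 : colon_ext a b f (f (1 - u1) * 1).
  apply: colon_ext_gen; have [v /= vE] := fstcoefP x1; exists v.
  by rewrite mulrBl mul1r {1}vE addrC addKr.
have ext2 : colon_ext a b f (f u2 * y).
  apply: colon_ext_gen; have [v /= vE] := fstcoefP x2; exists (1 - v).
  by rewrite mulrBl mul1r; apply/esym/eqP; rewrite subr_eq; apply/eqP.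
have [l [lP l1]] := colon_ext_add (colon_ext_add ext1 ext) ext2; exists l; split.
  move=> z /lP[c cE]; exists c; apply: (mulIf b0).
  by rewrite -rmorphM -cE rmorphM -mulrA [y * _]mulrC yE.
by rewrite l1 rmorphB rmorph1; ring.
Qed.

(** * Subrings of a field *)

Section InsideField.
Variable K : fieldType.
Implicit Types A B P Q W : K -> Prop.

Record subring_in A : Prop := SubringIn {
  subring_in1 : A 1;
  subring_inB : forall x y, A x -> A y -> A (x - y);
  subring_inM : forall x y, A x -> A y -> A (x * y) }.

Lemma subring_in0 A : subring_in A -> A 0.
Proof. by move=> hA; rewrite -(subrr 1); apply: subring_inB => //; exact: subring_in1. Qed.

Lemma subring_inN A x : subring_in A -> A x -> A (- x).
Proof. by move=> hA Ax; rewrite -sub0r; apply: subring_inB => //; exact: subring_in0. Qed.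

Lemma subring_inD A x y : subring_in A -> A x -> A y -> A (x + y).
Proof.
by move=> hA Ax Ay; rewrite -[y]opprK; apply: subring_inB => //; exact: subring_inN.
Qed.

Record prime_in A P : Prop := PrimeIn {
  prime_in_sub : forall x, P x -> A x;
  prime_in0 : P 0;
  prime_in1 : ~ P 1;
  prime_in_lin : forall a x y, A a -> P x -> P y -> P (a * x + y);
  prime_in_prime : forall x y, A x -> A y -> P (x * y) -> P x \/ P y }.

Lemma prime_inM A P a x : prime_in A P -> A a -> P x -> P (a * x).
Proof.
by move=> hP Aa Px; rewrite -[_ * _]addr0; apply: (prime_in_lin hP) => //; exact: (prime_in0 hP).
Qed.

Lemma prime_inD A P x y : subring_in A -> prime_in A P -> P x -> P y -> P (x + y).
Proof.
by move=> hA hP Px Py; rewrite -[x]mul1r; apply: (prime_in_lin hP) => //; exact: subring_in1.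
Qed.

Lemma prime_in_restrict A B P : (forall x, B x -> A x) -> subring_in B ->
  prime_in A P -> prime_in B (fun x => B x /\ P x).
Proof.
move=> BA hB [Psub P0 P1 Plin Pprime]; split.
- by move=> x [].
- by split=> //; exact: subring_in0.
- by case.
- move=> a x y Ba [Bx Px] [By Py]; split; last by apply: Plin => //; exact: BA.
  by apply: subring_inD => //; exact: subring_inM.
- by move=> x y Bx By [_ /Pprime]; case=> //; [exact: BA | exact: BA | left | right].
Qed.

Definition going_down_in B A : Prop :=
  forall p q Q, prime_in B p -> prime_in B q -> prime_in A Q ->
    (forall x, p x -> q x) -> (forall x, B x -> (Q x <-> q x)) ->
    exists P, [/\ prime_in A P, forall x, P x -> Q x &
      forall x, B x -> (P x <-> p x)].

(* (B : x) A = A for every x in A. *)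
Definition flat_in B A : Prop := forall x, A x ->
  exists l : seq (K * K), (forall z, z \in l -> [/\ B z.1, B (z.1 * x) & A z.2]) /\
    \sum_(z <- l) z.1 * z.2 = 1.

Definition localization_in B A : Prop :=
  exists W, [/\ W 1, forall x y, W x -> W y -> W (x * y), ~ W 0,
    forall x, W x -> B x &
    forall x, A x <-> exists a w, [/\ B a, W w & x = a / w]].

Definition glob_perinormal_in B : Prop :=
  forall A, subring_in A -> (forall x, B x -> A x) ->
    (going_down_in B A -> flat_in B A) /\ (flat_in B A -> localization_in B A).

(** For a fraction a/w the single relation w w^-1 = 1 suffices, since w clears a/w. *)
Lemma localization_in_flat B A :
  subring_in B -> localization_in B A -> flat_in B A.
Proof.
move=> hB [W [W1 _ W0 WB AW]] x /AW[a [w [Ba Ww ->]]].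
have w0 : w != 0 by apply/eqP => w0; apply: W0; rewrite -w0.
exists [:: (w, w^-1)]; rewrite big_seq1 /= divff //; split=> // z.
rewrite inE => /eqP -> /=; split; first exact: WB.
  by rewrite mulrCA divff // mulr1.
by apply/AW; exists 1, w; rewrite mul1r; split=> //; exact: subring_in1.
Qed.

End InsideField.

(** * Overrings of the pullback *)

Section PullbackInField.
Variables (k K : fieldType) (T : idomainType).
Variables (pi : {rmorphism T -> k}) (iota : {rmorphism T -> K}) (D : k -> Prop).
Hypothesis pi_surj : forall y, exists t, pi t = y.
Hypothesis pi_unit : forall t, pi t != 0 -> t \is a GRing.unit.
Hypothesis iota_inj : injective iota.
Hypothesis D_subring : subring_in D.
Hypothesis D_frac : forall y, exists a b, [/\ D a, D b, b != 0 & y = a / b].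

Definition pull (E : k -> Prop) (x : K) : Prop :=
  exists2 t, x = iota t & E (pi t).

Definition push (A : K -> Prop) (y : k) : Prop :=
  exists2 t, y = pi t & A (iota t).

Local Notation R := (pull D).
Local Notation Timg := (pull (fun=> True)).

Lemma pull_iota E t : pull E (iota t) <-> E (pi t).
Proof. by split=> [[s /iota_inj ->]|]; last exists t. Qed.

Lemma pull_subring E : subring_in E -> subring_in (pull E).
Proof.
move=> hE; split.
- by exists 1; rewrite rmorph1 //; exact: subring_in1.
- move=> _ _ [s -> Es] [t -> Et]; exists (s - t); rewrite rmorphB //.
  exact: subring_inB.
- move=> _ _ [s -> Es] [t -> Et]; exists (s * t); rewrite rmorphM //.
  exact: subring_inM.
Qed.

Lemma pull_mono E E' x : (forall y, E y -> E' y) -> pull E x -> pull E' x.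
Proof. by move=> EE' [t -> Et]; exists t => //; exact: EE'. Qed.

Lemma subring_Timg : subring_in Timg.
Proof. by apply: pull_subring; split. Qed.

Lemma R_sub_Timg x : R x -> Timg x.
Proof. exact: pull_mono. Qed.

Lemma pi_inv t : pi t != 0 -> pi t^-1 = (pi t)^-1.
Proof. by move=> /pi_unit; exact: rmorphV. Qed.

Lemma iota_inv t : pi t != 0 -> iota t^-1 = (iota t)^-1.
Proof. by move=> /pi_unit; exact: rmorphV. Qed.

Lemma iota_neq0 t : pi t != 0 -> iota t != 0.
Proof.
by apply: contra => /eqP; rewrite -(rmorph0 iota) => /iota_inj ->; rewrite rmorph0.
Qed.

(** The inclusion of [T] in R_M, for two elements at once: [w] lifts the product of the denominators
    of the two residues. *)
Lemma denominator t s :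
  exists w, [/\ pi w != 0, D (pi w), D (pi (w * t)) & D (pi (w * s))].
Proof.
have [a [b [Da Db b0 tE]]] := D_frac (pi t).
have [c [d [Dc Dd d0 sE]]] := D_frac (pi s).
have [w wE] := pi_surj (b * d); exists w; split.
- by rewrite wE mulf_neq0.
- by rewrite wE; exact: subring_inM.
- rewrite rmorphM wE tE (_ : b * d * (a / b) = d * a); last by field.
  exact: subring_inM.
- rewrite rmorphM wE sE (_ : b * d * (c / d) = b * c); last by field.
  exact: subring_inM.
Qed.

(** * Primes containing M and primes of the residue ring *)

Section PrimesContainingM.
Variables (E : k -> Prop) (P : K -> Prop).
Hypotheses (E_subring : subring_in E) (P_prime : prime_in (pull E) P).
Hypothesis M_sub_P : forall m, pi m = 0 -> P (iota m).

(** Since [P] contains M, membership depends only on the residue class. *)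
Lemma pushE t : push P (pi t) <-> P (iota t).
Proof.
split=> [[s ts Ps]|]; last by exists t.
rewrite -(subrK s t) rmorphD; apply: (prime_inD (pull_subring E_subring) P_prime) => //.
by apply: M_sub_P; rewrite rmorphB ts subrr.
Qed.

Lemma prime_push : prime_in E (push P).
Proof.
case: (P_prime) => Psub P0 P1 Plin Pprime; split.
- by move=> _ [t -> /Psub /pull_iota].
- by rewrite -(rmorph0 pi); apply/pushE; rewrite rmorph0.
- by rewrite -(rmorph1 pi) => /pushE; rewrite rmorph1.
- move=> a _ _ Ea [s -> Ps] [t -> Pt]; have [b bE] := pi_surj a.
  rewrite -bE -rmorphM -rmorphD; apply/pushE; rewrite rmorphD rmorphM.
  by apply: Plin => //; apply/pull_iota; rewrite bE.
- move=> x y; have [s <-] := pi_surj x; have [t <-] := pi_surj y => Es Et.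
  rewrite -rmorphM => /pushE; rewrite rmorphM => /Pprime.
  by case=> [||Ps|Pt]; [exact/pull_iota | exact/pull_iota | left | right]; exact/pushE.
Qed.

End PrimesContainingM.

Lemma prime_pull E P : prime_in E P -> prime_in (pull E) (pull P).
Proof.
case=> Psub P0 P1 Plin Pprime; split.
- by move=> x; exact: pull_mono.
- by exists 0; rewrite rmorph0.
- by rewrite -(rmorph1 iota) => /pull_iota; rewrite rmorph1.
- move=> _ _ _ [a -> Ea] [s -> Ps] [t -> Pt]; exists (a * s + t).
    by rewrite rmorphD rmorphM.
  by rewrite rmorphD rmorphM; exact: Plin.
- move=> _ _ [s -> Es] [t -> Et]; rewrite -rmorphM => /pull_iota.
  by rewrite rmorphM => /Pprime; case=> // [Ps|Pt]; [left | right]; exact/pull_iota.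
Qed.

(* Localizing at R \ M does not change the primes of R contained in M. *)
Lemma prime_of_T p A : subring_in A -> (forall x, R x -> A x) ->
  (forall x, A x -> Timg x) -> prime_in R p ->
  (forall t, p (iota t) -> pi t = 0) -> prime_in A p.
Proof.
move=> hA RA AT hp pM; case: (hp) => psub p0 p1 plin pprime.
(* [p] absorbs [T]: if w is a denominator of s, then w (s t) = (w s) t lies in [p], with s t in M
   and hence in [R], while w is outside [p] because [p] is contained in M. *)
have pT a x : Timg a -> p x -> p (a * x).
  move=> [s -> _] px; have [t xE _] := psub _ px; subst x.
  have [w [w0 Dw Dws _]] := denominator s s.
  have st0 : pi (s * t) = 0 by rewrite rmorphM (pM t) // mulr0.
  have : p (iota w * iota (s * t)).
    rewrite -rmorphM mulrA rmorphM; apply: (prime_inM hp) => //.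
    exact/pull_iota.
  case/pprime; [exact/pull_iota | | | by rewrite -rmorphM].
    by apply/pull_iota; rewrite st0; exact: subring_in0.
  by move=> /pM /eqP; rewrite (negbTE w0).
split=> //.
- by move=> x /psub /RA.
- move=> a x y /AT Ta px py; apply: (prime_inD (pull_subring D_subring) hp) => //.
  exact: pT.
- move=> x y /AT[s -> _] /AT[t -> _] pst.
  have [w [w0 Dw Dws Dwt]] := denominator s t.
  (* A denominator outside M is a unit of [T], so it cancels. *)
  have cancel u : p (iota (w * u)) -> p (iota u).
    move=> pwu; rewrite (_ : iota u = iota w^-1 * iota (w * u)).
      by apply: pT => //; exists w^-1.
    by rewrite -rmorphM mulKr //; exact: pi_unit.
  have : p (iota (w * s) * iota (w * t)).
    rewrite (_ : _ * _ = iota (w * w) * (iota s * iota t)).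
      by apply: pT => //; exists (w * w).
    by rewrite !rmorphM; ring.
  by case/pprime; [exact/pull_iota | exact/pull_iota | left | right]; exact: cancel.
Qed.

(** * Transfer between an overring E of D and its preimage *)

(** If [p] lies inside M it is already a prime of [pull E]. Otherwise it contains M, as do [q] and
    [Q], and the problem descends to [D] and [E]. *)
Lemma going_down_pull E : subring_in E -> (forall y, D y -> E y) ->
  going_down_in D E -> going_down_in R (pull E).
Proof.
move=> hE DE gd p q Q hp hq hQ pq Qq.
have RE x : R x -> pull E x by exact: pull_mono.
have [[t pt t0]|pM] := pselect (exists2 t, p (iota t) & pi t != 0); last first.
  exists p; split=> //; last by move=> x /pq qx; apply/Qq => //; exact: prime_in_sub hq _ qx.
  apply: prime_of_T => //; [exact: pull_subring | by move=> x; exact: pull_mono | ].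
  by move=> t pt; apply/eqP; apply: contrapT => t0; apply: pM; exists t => //; exact/negP.
have Mp m : pi m = 0 -> p (iota m).
  (* Here m = (t^-1 m) t with t in [p] and t^-1 m in M, hence in [R]. *)
  move=> m0; rewrite -(mulVKr (pi_unit t0) m) mulrC rmorphM; apply: (prime_inM hp) => //.
  by apply/pull_iota; rewrite rmorphM m0 mulr0; exact: subring_in0.
have Mq m : pi m = 0 -> q (iota m) by move=> /Mp /pq.
have MQ m : pi m = 0 -> Q (iota m).
  by move=> m0; apply/Qq; [apply/pull_iota; rewrite m0; exact: subring_in0 | exact: Mq].
have pqpush y : push p y -> push q y by move=> [s -> /pq]; exists s.
have [y Dy|P [hP PQ Pp]] := gd _ _ _ (prime_push D_subring hp Mp)
  (prime_push D_subring hq Mq) (prime_push hE hQ MQ) pqpush.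
  have [s sE] := pi_surj y; subst y.
  rewrite (pushE hE hQ MQ) (pushE D_subring hq Mq).
  by apply: Qq; exact/pull_iota.
exists (pull P); split; first exact: prime_pull.
  by move=> _ [s -> /PQ /(pushE hE hQ MQ)].
by move=> _ [s -> Ds]; rewrite pull_iota Pp // (pushE D_subring hp Mp).
Qed.

(** A prime lying over [pull p] contains M, so it comes from a prime of [E]. *)
Lemma going_down_push E : subring_in E -> (forall y, D y -> E y) ->
  going_down_in R (pull E) -> going_down_in D E.
Proof.
move=> hE DE gd p q Q hp hq hQ pq Qq.
have [x|_ [s -> Ds]|P [hP PQ Pp]] := gd _ _ _ (prime_pull hp) (prime_pull hq) (prime_pull hQ).
- exact: pull_mono.
- by rewrite !pull_iota; exact: Qq.
have MP m : pi m = 0 -> P (iota m).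
  move=> m0; apply/Pp; apply/pull_iota; rewrite m0; first exact: subring_in0.
  exact: prime_in0 hp.
exists (push P); split; first exact: prime_push.
  by move=> _ [s -> /PQ /pull_iota].
move=> y Dy; have [s sE] := pi_surj y; subst y.
by rewrite (pushE hE hP MP) Pp pull_iota.
Qed.

(** Lifting the relation from [E] gives a sum s in 1 + M, a unit of [T]; dividing the second factors
    by s restores 1 without changing their residues. *)
Lemma flat_pull E : subring_in E -> flat_in D E -> flat_in R (pull E).
Proof.
move=> hE fl _ [t -> Et]; have [l [lP l1]] := fl _ Et.
have [sec secK] := choice pi_surj.
pose s := \sum_(z <- l) sec z.1 * sec z.2.
have s1 : pi s = 1.
  by rewrite rmorph_sum /= -l1; apply: eq_bigr => z _; rewrite rmorphM !secK.
have s0 : pi s != 0 by rewrite s1 oner_neq0.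
exists [seq (iota (sec z.1), iota (s^-1 * sec z.2)) | z <- l]; split.
  move=> _ /mapP[z /lP[z1 z1t z2] -> /=]; split.
  - by apply/pull_iota; rewrite secK.
  - by rewrite -rmorphM; apply/pull_iota; rewrite rmorphM secK.
  - by apply/pull_iota; rewrite rmorphM pi_inv // s1 invr1 mul1r secK.
rewrite big_map /= -(rmorph1 iota) -(divrr (pi_unit s0)) {2}/s mulr_suml rmorph_sum.
by apply: eq_bigr => z _; rewrite -rmorphM mulrA mulrAC.
Qed.

Lemma flat_push E : flat_in R (pull E) -> flat_in D E.
Proof.
move=> fl y Ey; have [t tE] := pi_surj y; subst y.
have [l [lP l1]] := fl (iota t) (proj2 (pull_iota _ _) Ey).
(* Lifts are chosen on all of [K]; outside [T] the value 0 is a placeholder. *)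
have lft (x : K) : exists s, Timg x -> x = iota s.
  by have [[s xE _]|nx] := pselect (Timg x); [exists s | exists 0].
have [sec secK] := choice lft.
have secR z : z \in l -> [/\ z.1 = iota (sec z.1), z.2 = iota (sec z.2),
    D (pi (sec z.1)), D (pi (sec z.1 * t)) & E (pi (sec z.2))].
  move=> /lP[Rz Rzt Ez].
  have e1 := secK _ (R_sub_Timg Rz); have e2 : z.2 = iota (sec z.2).
    by apply: secK; apply: pull_mono Ez.
  move: Rz Rzt Ez; rewrite {1 2}e1 {1}e2 -rmorphM.
  by move=> /pull_iota ? /pull_iota ? /pull_iota ?.
exists [seq (pi (sec z.1), pi (sec z.2)) | z <- l]; split.
  by move=> _ /mapP[z /secR[_ _ z1 z1t z2] -> /=]; rewrite -rmorphM.
rewrite big_map /= -(rmorph1 pi).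
rewrite (_ : 1 = \sum_(z <- l) sec z.1 * sec z.2).
  by rewrite rmorph_sum; apply: eq_bigr => z _; rewrite rmorphM.
apply: iota_inj; rewrite rmorph1 -l1 rmorph_sum.
by apply: eq_big_seq => z /secR[e1 e2 _ _ _]; rewrite rmorphM -e1 -e2.
Qed.

(** Elements of [W] are inverted in [pull E], hence are units of [T]; their residues are nonzero and
    serve as denominators. *)
Lemma localization_push E : localization_in R (pull E) -> localization_in D E.
Proof.
move=> [W [W1 WM W0 WR AW]].
have WT w : W (iota w) -> pi w != 0.
  move=> Ww; have : pull E (iota w)^-1.
    apply/AW; exists 1, (iota w); rewrite mul1r; split=> //.
    exact: (subring_in1 (pull_subring D_subring)).
  move=> [v vE _]; have w0 : iota w != 0 by apply/eqP => w0; apply: W0; rewrite -w0.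
  have : w * v = 1 by apply: iota_inj; rewrite rmorphM -vE divff // rmorph1.
  move/(congr1 pi); rewrite rmorphM rmorph1 => wv.
  by apply/eqP => pw0; move: wv; rewrite pw0 mul0r => /eqP; rewrite eq_sym oner_eq0.
exists (push W); split.
- by exists 1; rewrite rmorph1.
- by move=> _ _ [s -> Ws] [t -> Wt]; exists (s * t); rewrite rmorphM //; exact: WM.
- by move=> [t t0 /WT]; rewrite -t0 eqxx.
- by move=> _ [t -> /WR /pull_iota].
move=> y; split.
- have [t <-] := pi_surj y => Et.
  have /AW[_ [w' [[a -> Da] Ww tE]]] : pull E (iota t) by exact/pull_iota.
  have [w wE _] := WR _ Ww; subst w'.
  have w0 := WT _ Ww.
  exists (pi a), (pi w); split=> //; first by exists w.
  apply: (mulIf w0); rewrite divfK // -rmorphM; congr (pi _); apply: iota_inj.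
  by rewrite rmorphM tE divfK //; exact: iota_neq0.
- move=> [a' [_ [Da [w -> Ww] ->]]]; have [a aE] := pi_surj a'; subst a'.
  rewrite -pi_inv; last exact: WT.
  rewrite -rmorphM; apply/pull_iota/AW; exists (iota a), (iota w); split=> //.
    exact/pull_iota.
  by rewrite rmorphM iota_inv //; exact: WT.
Qed.

(** The full preimage of [W] works: if t has residue a/w and v lifts w, then t v has residue a in
    [D], and t = (t v)/v. *)
Lemma localization_pull E : localization_in D E -> localization_in R (pull E).
Proof.
move=> [W [W1 WM W0 WD EW]].
have Wn w : W w -> w != 0 by move=> Ww; apply/eqP => w0; apply: W0; rewrite -w0.
exists (pull W); split.
- by exists 1; rewrite rmorph1.
- by move=> _ _ [s -> Ws] [t -> Wt]; exists (s * t); rewrite rmorphM //; exact: WM.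
- by rewrite -(rmorph0 iota) => /pull_iota; rewrite rmorph0.
- by move=> x; exact: pull_mono.
move=> x; split.
- move=> [t -> /EW[a [w [Da Ww tE]]]].
  have [v vE] := pi_surj w; subst w.
  have v0 := Wn _ Ww.
  exists (iota (t * v)), (iota v); split; [|exact/pull_iota|].
    by apply/pull_iota; rewrite rmorphM tE divfK.
  by rewrite rmorphM mulfK //; exact: iota_neq0.
- move=> [_ [_ [[a -> Da] [w -> Ww] ->]]].
  have w0 := Wn _ Ww.
  rewrite -iota_inv // -rmorphM; apply/pull_iota; rewrite rmorphM pi_inv //.
  by apply/EW; exists (pi a), (pi w).
Qed.

(** * Overrings containing T *)

Section OverT.
Variable A : K -> Prop.
Hypotheses (A_subring : subring_in A) (T_sub_A : forall x, Timg x -> A x).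

(** Elements of [T] outside M are units of [A], so [Q] meets [T] inside M, and [p] lies in M. Thus
    [p] is a prime of [T], and going-down over [T] applies to [p] and the trace of [Q] on [T]. *)
Lemma going_down_overT : going_down_in Timg A -> going_down_in R A.
Proof.
move=> gd p q Q hp hq hQ pq Qq.
have QM t : Q (iota t) -> pi t = 0.
  move=> Qt; apply/eqP; apply: contrapT => /negP t0; apply: (prime_in1 hQ).
  rewrite -(rmorph1 iota) -(mulVr (pi_unit t0)) rmorphM.
  by apply: (prime_inM hQ) => //; apply: T_sub_A; exists t^-1.
have pM t : p (iota t) -> pi t = 0.
  by move=> /pq qt; apply: QM; apply/Qq => //; exact: (prime_in_sub hq).
have hpT : prime_in Timg p.
  by apply: prime_of_T => //; [exact: subring_Timg | exact: R_sub_Timg].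
have hQT := prime_in_restrict T_sub_A subring_Timg hQ.
have [x px|x Tx|P [hP PQ Pp]] := gd _ _ _ hpT hQT hQ.
- split; first exact: (prime_in_sub hpT).
  by apply/Qq; [exact: prime_in_sub hp _ px | exact: pq].
- by split=> [|[]].
by exists P; split=> // x /R_sub_Timg; exact: Pp.
Qed.

(** Denominators outside M bring each first factor and its product with x into [R]; their inverses
    lie in [T], hence in [A], and go to the second factors. *)
Lemma flat_overT : flat_in Timg A -> flat_in R A.
Proof.
move=> fl x Ax; have [l [lP l1]] := fl x Ax.
have den (z : K * K) : exists w, z \in l ->
    [/\ pi w != 0, R (iota w * z.1) & R (iota w * z.1 * x)].
  have [zl|_] := boolP (z \in l); last by exists 0.
  have [[s sE _] [t tE _] _] := lP z zl.
  have [w [w0 _ ws wt]] := denominator s t; exists w => _.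
  by rewrite -mulrA tE sE -!rmorphM; split=> //; exact/pull_iota.
have [d dP] := choice den.
exists [seq (iota (d z) * z.1, (iota (d z))^-1 * z.2) | z <- l]; split.
  move=> _ /mapP[z zl ->] /=; have [d0 R1 R2] := dP z zl; split=> //.
  apply: (subring_inM A_subring); last by case: (lP z zl).
  by rewrite -iota_inv //; apply: T_sub_A; exists (d z)^-1.
rewrite big_map -l1; apply: eq_big_seq => z /dP[/iota_neq0 d0 _ _] /=.
by rewrite mulrACA divff // mul1r.
Qed.

Lemma flat_restrict : flat_in R A -> flat_in Timg A.
Proof.
move=> fl x /fl[l [lP l1]]; exists l; split=> // z /lP[z1 z1x z2].
by split=> //; exact: R_sub_Timg.
Qed.

Lemma localization_restrict : localization_in R A -> localization_in Timg A.
Proof.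
move=> [W [W1 WM W0 WR AW]]; exists W; split=> //.
  by move=> x /WR; exact: R_sub_Timg.
move=> x; split.
  by move=> /AW[a [w [Ra Ww ->]]]; exists a, w; split=> //; exact: R_sub_Timg.
move=> [a [w [Ta Ww ->]]]; apply: subring_inM => //; first exact: T_sub_A.
apply/AW; exists 1, w; rewrite mul1r; split=> //.
exact: (subring_in1 (pull_subring D_subring)).
Qed.

(** The hypothesis is the valuation property of [T] with maximal ideal M. An x in [T] has a
    denominator outside M, invertible in [T]; a nonzero x with x^-1 in M is 1 / x^-1 with x^-1 in
    [R]. *)
Lemma localization_overT_valuation :
  (forall x, Timg x \/ exists2 m, x^-1 = iota m & pi m = 0) -> localization_in R A.
Proof.
move=> val; exists (fun w => [/\ R w, w != 0 & A w^-1]).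
have RS := pull_subring D_subring.
split.
- by rewrite invr1; split; [exact: subring_in1 | exact: oner_neq0 | exact: subring_in1].
- move=> x y [Rx x0 Ax] [Ry y0 Ay]; split; [exact: subring_inM | exact: mulf_neq0 |].
  by rewrite invfM; exact: subring_inM.
- by case; rewrite eqxx.
- by move=> x [].
move=> x; split; last first.
  move=> [a [w [Ra [Rw w0 Aw] ->]]]; apply: subring_inM => //.
  exact/T_sub_A/R_sub_Timg.
move=> Ax; have [[t tE _]|[m mE m0]] := val x.
  have [w [w0 Dw Dwt _]] := denominator t t.
  exists (iota (w * t)), (iota w); split; [exact/pull_iota| |].
    split; [exact/pull_iota | exact: iota_neq0 |].
    by rewrite -iota_inv //; apply: T_sub_A; exists w^-1.
  by rewrite rmorphM mulrAC divff ?mul1r //; exact: iota_neq0.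
(* Since 0^-1 = 0, the second alternative also covers 0, which is written as 0/1. *)
have [->|x0] := eqVneq x 0.
  exists 0, 1; rewrite mul0r invr1; split=> //; first exact: subring_in0.
  by split; [exact: subring_in1 | exact: oner_neq0 | exact: subring_in1].
exists 1, x^-1; rewrite mul1r invrK; split=> //; first exact: subring_in1.
split; rewrite ?invr_eq0 // mE; apply/pull_iota; rewrite m0; exact: subring_in0.
Qed.

End OverT.

(** * Passing global perinormality between the three rings *)

Lemma glob_perinormal_T : glob_perinormal_in R -> glob_perinormal_in Timg.
Proof.
move=> gR A hA TA; have [gf fl] := gR A hA (fun x Rx => TA x (R_sub_Timg Rx)).
split=> [gd|/flat_overT ff]; first exact/flat_restrict/gf/going_down_overT.
exact/localization_restrict/fl/ff.
Qed.

Lemma glob_perinormal_D : glob_perinormal_in R -> glob_perinormal_in D.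
Proof.
move=> gR E hE DE.
have [gf fl] := gR _ (pull_subring hE) (fun x => @pull_mono _ _ x DE).
split=> [gd|ff]; first exact/flat_push/gf/going_down_pull.
exact/localization_push/fl/flat_pull.
Qed.

Lemma glob_perinormal_pullback :
  (forall x, Timg x \/ exists2 m, x^-1 = iota m & pi m = 0) ->
  glob_perinormal_in D -> glob_perinormal_in R.
Proof.
move=> val gD A hA RA.
(* Either [A] lies inside [T], and is then the preimage of its residue ring, or it contains some x
   outside [T]. *)
have [AT|/existsNP[x /not_implyP[Ax nTx]]] := pselect (forall x, A x -> Timg x).
  have MA m : pi m = 0 -> A (iota m).
    by move=> m0; apply/RA/pull_iota; rewrite m0; exact: subring_in0.
  have AE : A = pull (push A).
    apply/funext => x; apply/propext; split=> [Ax|[t -> [s ts As]]].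
      by have [t tE _] := AT _ Ax; subst x; exists t => //; exists t.
    rewrite -(subrK s t) rmorphD; apply: subring_inD => //.
    by apply: MA; rewrite rmorphB ts subrr.
  have hE : subring_in (push A).
    split.
    - by exists 1; rewrite rmorph1 //; exact: subring_in1.
    - move=> _ _ [s -> As] [t -> At]; exists (s - t); rewrite rmorphB //.
      exact: subring_inB.
    - move=> _ _ [s -> As] [t -> At]; exists (s * t); rewrite rmorphM //.
      exact: subring_inM.
  have DE y : D y -> push A y.
    by have [t <-] := pi_surj y => Dt; exists t => //; exact/RA/pull_iota.
  have [gf fl] := gD _ hE DE; rewrite AE; split=> [gd|ff].
    exact/flat_pull/gf/going_down_push.
  exact/localization_pull/fl/flat_push.
have loc : localization_in R A.
  apply: localization_overT_valuation => // y [t -> _].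
  have [//|[m mE m0]] := val x.
  have x0 : x != 0.
    by apply/eqP => x0; apply: nTx; rewrite x0; exact: (subring_in0 subring_Timg).
  (* Each t equals x (x^-1 t), where x^-1 t lies in M and hence in [R]; so [A] contains [T]. *)
  rewrite -[iota t](mulVKf x0) mE; apply: (subring_inM hA) => //.
  rewrite -rmorphM; apply/RA/pull_iota; rewrite rmorphM m0 mul0r.
  exact: subring_in0.
by split=> // _; apply: localization_in_flat => //; exact: pull_subring.
Qed.

End PullbackInField.

(** * Transfer to overrings of the fraction field *)

Lemma subf_div (F : fieldType) (a b c d : F) : b != 0 -> d != 0 ->
  a / b - c / d = (a * d - c * b) / (b * d).
Proof. by move=> b0 d0; rewrite -mulNr addf_div // mulNr. Qed.

Section FractionMap.
Variables (R : idomainType) (K : fieldType) (j : {rmorphism R -> K}).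
Hypothesis j_inj : injective j.
Hypothesis j_frac : forall x, exists a b : R, b != 0 /\ x = j a / j b.
Local Notation "x %:F" := (@FracField.tofrac R x).

Local Open Scope quotient_scope.
(** Unfolds the quotient construction, where equality of classes is cross multiplication. *)
Lemma fraction_repr (x : {fraction R}) : exists a b : R, b != 0 /\ x = a%:F / b%:F.
Proof.
elim/quotW: x => r; exists (\n_r), (\d_r); split; first exact: denom_ratioP.
unlock FracField.tofrac; rewrite -[RHS]/(FracField.mul _ (FracField.inv _)) !piE.
apply/eqmodP; rewrite /= FracField.equivfE /FracField.mulf /FracField.invf.
by rewrite !numden_Ratio ?(oner_neq0, denom_ratioP, mulr1, mul1r) // mulrC.
Qed.
Local Close Scope quotient_scope.

(** Uniqueness of the fraction field: sending a/b to j a / j b is well defined because [j] is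
    injective, and onto because [K] consists of such quotients. *)
Lemma frac_map_exists : exists phi : {rmorphism {fraction R} -> K},
  [/\ injective phi, forall x, exists y, phi y = x & forall r, phi r%:F = j r].
Proof.
have tofrac_neq0 (r : R) : r != 0 -> r%:F != 0 by rewrite tofrac_eq0.
have j_neq0 (r : R) : r != 0 -> j r != 0 by rewrite -(rmorph0 j) (inj_eq j_inj).
have [num] := choice fraction_repr => /choice[den ndP].
pose phi x := j (num x) / j (den x).
(* Independence of the representing fraction; additivity and multiplicativity follow from it. *)
have phiE x (a b : R) : b != 0 -> x = a%:F / b%:F -> phi x = j a / j b.
  move=> b0; have [d0 xE] := ndP x; rewrite {1}xE => /eqP.
  rewrite eqr_div ?tofrac_neq0 // -!tofracM tofrac_eq => /eqP e.
  by apply/eqP; rewrite /phi eqr_div ?j_neq0 // -!rmorphM e.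
have phiB : zmod_morphism phi.
  move=> x y; have [x0 xE] := ndP x; have [y0 yE] := ndP y.
  rewrite (phiE (x - y) (num x * den y - num y * den x) (den x * den y)).
  - by rewrite /phi rmorphB !rmorphM subf_div ?j_neq0.
  - exact: mulf_neq0.
  - by rewrite {1}xE {1}yE subf_div ?tofrac_neq0 // tofracB !tofracM.
have phiM : monoid_morphism phi.
  split; first by rewrite (phiE 1 1 1) ?oner_neq0 // ?tofrac1 ?rmorph1 divr1.
  move=> x y; have [x0 xE] := ndP x; have [y0 yE] := ndP y.
  rewrite (phiE (x * y) (num x * num y) (den x * den y)).
  - by rewrite /phi !rmorphM mulf_div.
  - exact: mulf_neq0.
  - by rewrite {1}xE {1}yE !tofracM mulf_div.
pose phim : {rmorphism {fraction R} -> K} := HB.pack phi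
  (GRing.isZmodMorphism.Build _ _ phi phiB) (GRing.isMonoidMorphism.Build _ _ phi phiM).
exists phim; split.
- exact: fmorph_inj.
- move=> x; have [a [b [b0 ->]]] := j_frac x; exists (a%:F / b%:F).
  exact: phiE.
- by move=> r; rewrite -[LHS]/(phi _) (phiE _ r 1) ?oner_neq0 // ?tofrac1 ?rmorph1 divr1.
Qed.

End FractionMap.

(** * Primes, going-down and flatness read in a common field *)

Definition img (R : Type) (K : Type) (j : R -> K) (x : K) : Prop :=
  exists r, x = j r.

Section PrimeTransfer.
Variables (R : comNzRingType) (K : fieldType) (j : {rmorphism R -> K}).
Hypothesis j_inj : injective j.

Lemma img_subring : subring_in (img j).
Proof.
split; first by exists 1; rewrite rmorph1.
- by move=> _ _ [r ->] [s ->]; exists (r - s); rewrite rmorphB.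
- by move=> _ _ [r ->] [s ->]; exists (r * s); rewrite rmorphM.
Qed.

Definition img_pred (P : {pred R}) (x : K) : Prop := exists2 r, x = j r & r \in P.

Lemma img_predE (P : {pred R}) r : img_pred P (j r) <-> r \in P.
Proof. by split=> [[s /j_inj->]|]; last exists r. Qed.

Lemma prime_img (P : prime_idealr R) : prime_in (img j) (img_pred P).
Proof.
split.
- by move=> _ [r -> _]; exists r.
- by exists 0; rewrite ?rmorph0 ?idealr0.
- by rewrite -(rmorph1 j) img_predE idealr1.
- move=> _ _ _ [a ->] [r -> rP] [s -> sP]; exists (a * r + s).
    by rewrite rmorphD rmorphM.
  by rewrite rpredD // idealMr.
- move=> _ _ [r ->] [s ->]; rewrite -rmorphM !img_predE prime_idealrM => /orP.
  by [].
Qed.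

(** Turns a prime predicate into a bundled prime ideal, the form over which [going_down]
    quantifies. *)
Lemma prime_contraction (P : K -> Prop) : prime_in (img j) P ->
  exists P' : prime_idealr R, forall r, r \in P' <-> P (j r).
Proof.
case=> Psub P0 P1 Plin Pprime; pose P' (r : R) : bool := `[< P (j r) >].
have P'E r : r \in P' <-> P (j r) by split=> [/asboolP|?]; last exact/asboolP.
have P'id : idealr_closed P'.
  split; [| |move=> a r s /P'E Pr /P'E Ps].
  - by apply/P'E; rewrite rmorph0.
  - by apply/negP => /P'E; rewrite rmorph1.
  - by apply/P'E; rewrite rmorphD rmorphM; apply: Plin => //; exists a.
have P'prime : prime_idealr_closed P'.
  move=> r s /P'E; rewrite rmorphM => Prs; apply/orP; rewrite !P'E.
  by apply: Pprime Prs; [exists r | exists s].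
pose P'' : prime_idealr R := HB.pack P' (isIdealr.Build R P' P'id)
  (isPrimeIdealrClosed.Build R P' P'prime).
by exists P''.
Qed.

End PrimeTransfer.

Section OverringTransfer.
Variables (R S : idomainType) (K : fieldType).
Variables (f : {rmorphism R -> S}) (g : {rmorphism S -> K}) (j : {rmorphism R -> K}).
Hypotheses (j_inj : injective j) (g_inj : injective g) (gf : forall r, g (f r) = j r).
Hypothesis j_frac : forall x, exists a b : R, b != 0 /\ x = j a / j b.

Lemma going_down_img : going_down f <-> going_down_in (img j) (img g).
Proof.
split=> gd p q Q.
  move=> hp hq hQ pq Qq.
  have [p' pE] := prime_contraction hp; have [q' qE] := prime_contraction hq.
  have [Q' QE] := prime_contraction hQ.
  have [r /pE /pq /qE //|r|P [PQ Pp]] := gd p' q' Q'.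
    by apply/idP/idP; rewrite qE QE gf => /Qq; apply; exists r.
  exists (img_pred g P); split; first exact: prime_img.
    by move=> _ [s -> /PQ /QE].
  by move=> _ [r ->]; rewrite -gf img_predE // Pp pE gf.
move=> pq Qq.
have [_ [r -> /pq rq]|_ [r ->]|P [hP PQ Pp]] :=
    gd _ _ _ (prime_img j_inj p) (prime_img j_inj q) (prime_img g_inj Q).
- by exists r.
- by rewrite -{1}gf !img_predE // Qq.
have [P' PE] := prime_contraction hP; exists P'; split.
  by move=> s /PE /PQ /(img_predE g_inj).
move=> r; have jr : img j (j r) by exists r.
have e : r \in p <-> P (j r) by rewrite (Pp _ jr) img_predE.
by apply/idP/idP; rewrite PE gf => ?; exact/e.
Qed.

(** Richman's criterion. For necessity, y is written as a/b in [K] and [colon_of_flat] is applied to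
    this fraction; for sufficiency, the pairs in [K] are pulled back to [R] and [S] and show that
    the conductor is dense. *)
Lemma flat_img : flat_morphism f <-> flat_in (img j) (img g).
Proof.
have f_inj : injective f by move=> r s e; apply: j_inj; rewrite -!gf e.
split=> [fl _ [y ->]|fl].
  have [a [b [b0 yE]]] := j_frac (g y).
  have jb0 : j b != 0 by rewrite -(rmorph0 j) (inj_eq j_inj).
  have fb0 : f b != 0 by rewrite -(rmorph0 f) (inj_eq f_inj).
  have [|l [lP l1]] := colon_of_flat (a := a) (y := y) fl fb0.
    by apply: g_inj; rewrite rmorphM !gf yE mulrC divfK.
  exists [seq (j z.1, g z.2) | z <- l]; split.
    move=> _ /mapP[z /lP[c cE] ->] /=; split; [by exists z.1 | | by exists z.2].
    by exists c; rewrite -!gf cE rmorphM.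
  by rewrite big_map -(rmorph1 g) -l1 rmorph_sum; apply: eq_bigr => z _; rewrite rmorphM gf.
apply: flat_of_dense_clears => // y; have [|l [lP l1]] := fl (g y); first by exists y.
have sel (z : K * K) : exists rs : R * S, z \in l -> z.1 = j rs.1 /\ z.2 = g rs.2.
  have [/lP[[r rE] _ [s sE]]|_] := boolP (z \in l); last by exists (0, 0).
  by exists (r, s).
have [rs rsP] := choice sel.
exists [seq rs z | z <- l]; split.
  rewrite big_map; apply: g_inj; rewrite rmorph1 -l1 rmorph_sum.
  by apply: eq_big_seq => z /rsP[e1 e2]; rewrite rmorphM gf -e1 -e2.
move=> _ /mapP[z zl ->] r; have [e1 _] := rsP z zl; have [_ [c cE] _] := lP z zl.
by exists (r * c); apply: g_inj; rewrite !rmorphM !gf -cE e1 mulrA.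
Qed.

End OverringTransfer.

(** * Independence of global perinormality from the model of the fraction field *)

Section GlobTransfer.
Variables (R : idomainType) (K : fieldType) (j : {rmorphism R -> K}).
Hypothesis j_inj : injective j.
Hypothesis j_frac : forall x, exists a b : R, b != 0 /\ x = j a / j b.

(** The isomorphism [phi] matches overrings of [R] with subrings of [K] containing the image of [R],
    and carries the three properties along. *)
Lemma glob_perinormal_img : globally_perinormal R <-> glob_perinormal_in (img j).
Proof.
have [phi [phi_inj phi_surj phiE]] := frac_map_exists j_inj j_frac.
have transfer (S : overring R) (A : K -> Prop) :
    (forall x, x \in overring_set S <-> A (phi x)) ->
    [/\ going_down_overring S <-> going_down_in (img j) A,
        flat_overring S <-> flat_in (img j) A &
        is_localization S <-> localization_in (img j) A].
  move=> SA; pose g : {rmorphism subring S -> K} := phi \o val.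
  have g_inj : injective g by exact: inj_comp phi_inj val_inj.
  have gf r : g (incl S r) = j r by rewrite -phiE.
  have -> : A = img g.
    apply/funext => x; apply/propext; split=> [Ax|[s ->]]; last exact/SA/srvalP.
    have [y yE] := phi_surj x; subst x; have yS : y \in overring_set S by exact/SA.
    by exists (Subring yS).
  split; [exact: going_down_img | exact: flat_img |].
  split=> [[W [[W1 WM] W0 SW]]|[W [W1 WM W0 WR AW]]].
    exists (img_pred j W); split.
    - by exists 1; rewrite ?rmorph1.
    - by move=> _ _ [r -> rW] [s -> sW]; exists (r * s); rewrite ?rmorphM ?WM.
    - by rewrite -(rmorph0 j) img_predE //; exact/negP.
    - by move=> _ [r -> _]; exists r.
    move=> x; have [y <-] := phi_surj x; split.
      move=> [s /phi_inj yE]; have /SW[a [w [wW ->]]] : y \in overring_set S.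
        by rewrite yE; exact: srvalP.
      exists (j a), (j w); rewrite fmorph_div !phiE; split=> //; first by exists a.
      by exists w.
    move=> [_ [_ [[a ->] [w -> wW] yE]]].
    have yS : y \in overring_set S.
      by apply/SW; exists a, w; split=> //; apply: phi_inj; rewrite fmorph_div !phiE.
    by exists (Subring yS).
  exists (fun r => `[< W (j r) >]); split.
  - split; first by apply/asboolP; rewrite rmorph1.
    by move=> r s /asboolP Wr /asboolP Ws; apply/asboolP; rewrite rmorphM; exact: WM.
  - by apply/asboolPn; rewrite rmorph0.
  move=> x; split.
    move=> xS; have /AW[_ [w' [[a ->] Ww xE]]] : img g (phi x) by exists (Subring xS).
    have [w wE] := WR _ Ww; subst w'; exists a, w; split; first exact/asboolP.
    by apply: phi_inj; rewrite fmorph_div !phiE.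
  move=> [a [w [/asboolP Ww ->]]].
  have /AW[s /phi_inj ->] : exists a' w', [/\ img j a', W w' &
      phi (FracField.tofrac a / FracField.tofrac w) = a' / w'].
    by exists (j a), (j w); rewrite fmorph_div !phiE; split=> //; exists a.
  exact: srvalP.
split=> [[pn loc] A hA jA|gj].
  pose A' (x : {fraction R}) : bool := `[< A (phi x) >].
  have A'ring : GRing.subring_closed A'.
    split=> [|x y /asboolP Ax /asboolP Ay|x y /asboolP Ax /asboolP Ay]; apply/asboolP.
    - by rewrite rmorph1; exact: subring_in1.
    - by rewrite rmorphB; exact: subring_inB.
    - by rewrite rmorphM; exact: subring_inM.
  pose A'' : subringClosed {fraction R} :=
    HB.pack A' (GRing.isSubringClosed.Build _ A' A'ring).
  have A''P r : FracField.tofrac r \in A''.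
    by apply/asboolP; rewrite phiE; apply: jA; exists r.
  have [x|gdE flE locE] := transfer (Overring A''P) A.
    by split=> /asboolP.
  split; first by move=> /gdE /pn /flE.
  by move=> /flE /loc /locE.
have over (S : overring R) : exists A, [/\ subring_in A, forall x, img j x -> A x &
    forall x, x \in overring_set S <-> A (phi x)].
  have SE x : x \in overring_set S <-> img_pred phi (overring_set S) (phi x).
    by rewrite img_predE.
  exists (img_pred phi (overring_set S)); split=> //.
    split.
    - by rewrite -(rmorph1 phi); apply/SE; exact: rpred1.
    - by move=> _ _ [x -> xS] [y -> yS]; rewrite -rmorphB; apply/SE; exact: rpredB.
    - by move=> _ _ [x -> xS] [y -> yS]; rewrite -rmorphM; apply/SE; exact: rpredM.
  by move=> _ [r ->]; rewrite -phiE; apply/SE; exact: overringP.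
split=> S; have [A [hA jA SA]] := over S; have [gdE flE locE] := transfer S A SA;
  have [gf fl] := gj A hA jA.
  by move=> /gdE /gf /flE.
by move=> /flE /fl /locE.
Qed.

End GlobTransfer.

(** * Existence of maximal ideals *)

(** Zorn's lemma for proper ideals containing [t]; it serves to show that elements outside the
    maximal ideal of a local ring are units. *)
Lemma maximal_ideal_of_nonunit (T : comUnitRingType) (t : T) :
  t \isn't a GRing.unit -> exists2 N : {pred T}, maximal_ideal N & t \in N.
Proof.
move=> tU.
pose idl (J : set T) := [/\ J 0, ~ J 1, J t &
  forall a x y, J x -> J y -> J (a * x + y)].
(* The empty set is admitted so that the empty chain has an upper bound. *)
have [F FP Ftot|J [Jid Jmax]] := @Zorn_bigcup T (fun J => J = set0 \/ idl J).
  have [[X [FX X0]]|F0] := pselect (exists X, F X /\ X <> set0); last first.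
    left; apply/seteqP; split=> // x [X FX Xx]; apply: F0; exists X; split=> //.
    by move=> XE; rewrite XE in Xx.
  have idlF Y x : F Y -> Y x -> idl Y.
    by move=> /FP[->|].
  right; have [X00 _ Xt _] : idl X by case: (FP _ FX).
  split; [by exists X | | by exists X |].
    by move=> [Y FY Y1]; have [_ /(_ Y1)] := idlF _ _ FY Y1.
  move=> a x y [Y FY Yx] [Z FZ Zy].
  have [_ _ _ Ylin] := idlF _ _ FY Yx; have [_ _ _ Zlin] := idlF _ _ FZ Zy.
  have [YZ|ZY] := Ftot _ _ FY FZ.
    by exists Z => //; apply: Zlin => //; exact: YZ.
  by exists Y => //; apply: Ylin => //; exact: ZY.
have {Jid} [J0 J1 Jt Jlin] : idl J.
  (* The maximal set is not empty: the principal ideal of the nonunit [t] is proper and strictly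
     larger. *)
  case: Jid => // J0; exfalso.
  pose I : set T := [set x | exists a, x = a * t]%classic.
  have It : I t by exists 1; rewrite mul1r.
  apply: (Jmax I); last right.
    by rewrite J0; split=> [x //|/(_ _ It)].
  split=> //; first by exists 0; rewrite mul0r.
    by move=> [a at1]; case/negP: tU; apply/unitrPr; exists a; rewrite mulrC.
  by move=> a _ _ [x ->] [y ->]; exists (a * x + y); rewrite mulrDl mulrA.
pose N : {pred T} := fun x => `[< J x >].
have NE x : x \in N <-> J x by split=> [/asboolP|?]; last exact/asboolP.
exists N; last exact/NE; split.
  split=> [||a x y /NE Jx /NE Jy]; [exact/NE | by apply/negP => /NE |].
  by apply/NE; exact: Jlin.
move=> J' [J'0 J'1 J'lin] NJ' x; apply/idP/idP; last exact: NJ'.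
(* A proper ideal strictly above [N] would contradict the maximality of [J]. *)
move=> J'x; apply/NE; apply: contrapT => nJx; apply: (Jmax [set y | y \in J']%classic).
  by split=> [y /NE /NJ' //|/(_ _ J'x)].
right; split=> //; first exact/negP.
by apply: NJ'; apply/NE.
Qed.

(** * Assembly inside the fraction field of T *)

Theorem corollary3p6 (D T : idomainType) (M : {pred T})
    (pi : {rmorphism T -> {fraction D}})
    (T_local : local_ring M)
    (pi_surj : forall x : {fraction D}, exists t : T, pi t = x)
    (pi_ker : forall t : T, t \in M <-> pi t = 0) :
  (globally_perinormal (pullback pi) ->
     globally_perinormal D /\ globally_perinormal T) /\
  (valuation_domain T -> globally_perinormal D ->
     globally_perinormal (pullback pi)).
Proof.
(* A nonunit lies in a maximal ideal, which is [M] by locality, and [M] is the kernel of [pi]. *)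
have pi_unit t : pi t != 0 -> t \is a GRing.unit.
  apply: contraR => /maximal_ideal_of_nonunit[N Nmax tN].
  by apply/eqP/pi_ker; rewrite -(proj2 T_local N Nmax).
pose iota : {rmorphism T -> {fraction T}} := @FracField.tofrac T.
pose emb : {rmorphism D -> {fraction D}} := @FracField.tofrac D.
pose DD := img emb; have DD_subring : subring_in DD := img_subring emb.
have iota_inj : injective iota by move=> x y /eqP; rewrite tofrac_eq => /eqP.
have emb_inj : injective emb by move=> x y /eqP; rewrite tofrac_eq => /eqP.
have DD_frac y : exists a b, [/\ DD a, DD b, b != 0 & y = a / b].
  have [a [b [b0 ->]]] := fraction_repr y; exists (emb a), (emb b).
  by split; [exists a | exists b | rewrite tofrac_eq0 |].
pose j : {rmorphism pullback pi -> {fraction T}} := iota \o val.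
have j_inj : injective j by exact: inj_comp iota_inj val_inj.
have inR t : DD (pi t) -> exists r : pullback pi, val r = t.
  move=> tD; have tR : t \in pullback_subring pi by apply/asboolP.
  by exists (Subring tR).
have jE : img j = pull pi iota DD.
  apply/funext => x; apply/propext; split=> [[r ->]|[t -> /inR[r <-]]]; last by exists r.
  by exists (val r) => //; have /asboolP := srvalP r.
have iotaE : img iota = pull pi iota (fun=> True).
  by apply/funext => x; apply/propext; split=> [[t ->]|[t ->]]; exists t.
(* A fraction t/s equals (w t)/(w s) with both terms in the pullback, so the pullback has the same
   fraction field as [T]. *)
have j_frac x : exists a b : pullback pi, b != 0 /\ x = j a / j b.
  have [t [s [s0 ->]]] := fraction_repr x.
  have [w [w0 _ /inR[a aE] /inR[b bE]]] :=
    denominator pi_surj DD_subring DD_frac t s.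
  have iw0 : iota w != 0 by exact: iota_neq0 w0.
  exists a, b; rewrite /j /= aE bE !rmorphM -mulf_div divff // mul1r; split=> //.
  rewrite -(inj_eq val_inj) bE mulf_neq0 //.
  by apply: contraNneq w0 => ->; rewrite rmorph0.
rewrite (glob_perinormal_img j_inj j_frac) jE (glob_perinormal_img emb_inj (@fraction_repr D)).
rewrite (glob_perinormal_img iota_inj (@fraction_repr T)) iotaE.
split=> [gR|T_val].
  split; [exact: glob_perinormal_D gR | exact: glob_perinormal_T gR].
apply: glob_perinormal_pullback => // x.
(* For x outside [T], x^-1 = m lies in [T] and is not a unit, since otherwise x = m^-1 would lie in
   [T]; hence [pi] kills m. *)
have [[t ->]|nx] := pselect (exists t, x = iota t); first by left; exists t.
have x0 : x != 0 by apply: contra_notN nx => /eqP->; exists 0; rewrite rmorph0.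
have [//|[m mE]] := T_val x x0; right; exists m => //.
apply/eqP; apply: contrapT => /negP /pi_unit mU; apply: nx.
by exists m^-1; rewrite rmorphV // -[iota m]mE invrK.
Qed.
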